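(* Let $A_c\in\mathbb{R}^{p\times p}$, $B_c\in\mathbb{R}^{p\times m}$, $C\in\mathbb{R}^{q\times p}$, and let $\gamma(x,u;\theta)\in\mathbb{R}^p$ be a function of $x\in\mathbb{R}^p$, $u\in\mathbb{R}^m$ and a parameter vector $\theta$, such that $\gamma(x,u;\theta_0)\equiv 0$ for some parameter value $\theta_0$. Consider the augmented system with state $(x,K,\theta)$, input $u$, output $y=Cx$ and dynamics $$\begin{bmatrix}\dot{x}\\ \dot{K}\\ \dot{\theta}\end{bmatrix}=\begin{bmatrix}A_cx+B_cu+\gamma(x,u;\theta)+K\\ 0\\ 0\end{bmatrix}.$$ Then a necessary condition for the observability of this system is that $\operatorname{rank}(C)=p$; likewise, $\operatorname{rank}(C)=p$ is a necessary condition for the detectability of this system.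
   Context: The augmented system arises from the control system $\dot{x}=A_cx+B_cu+g_c(x,u)$, $y=Cx$, with state $x\in\mathbb{R}^p$, input $u\in\mathbb{R}^m$ and output $y\in\mathbb{R}^q$, where the unmodeled dynamics are parameterized as $g_c(x,u)=\gamma(x,u;\theta)+K$ with $K\in\mathbb{R}^p$ an unknown constant, non-zero vector (with no special structure) and $\theta$ an unknown constant parameter. Not all states need be measured. Observability and detectability have their usual meaning: the system is observable if any two distinct initial augmented states $(x,K,\theta)$ can be distinguished from the outputs $y$ they produce under the same inputs $u$; it is detectable if any two augmented state trajectories that produce identical outputs under the same input have difference tending to $0$ as $t\to\infty$. *)

(* Defs.v *)
From HB Require Import structures.
From mathcomp Require Import all_boot all_order all_algebra.
From mathcomp Require Import all_classical all_reals all_analysis.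
Set Implicit Arguments.
Unset Strict Implicit.
Unset Printing Implicit Defensive.
Import Order.TTheory GRing.Theory Num.Theory.
Import numFieldNormedType.Exports.
Local Open Scope classical_set_scope.
Local Open Scope ring_scope.

(* [z] solves z' = F (z, u) on [0, T] and stays in the state set [X]. Inputs may
   be discontinuous (e.g. piecewise continuous), so [z] is only required to be
   continuous on [0, T] and to satisfy the differential equation in ]0, T[ off
   a finite set of switching times. *)
Definition trajectory (R : realType) (V : normedModType R) (W : Type)
    (X : set V) (F : V -> W -> V) (u : R -> W) (T : R) (z : R -> V) : Prop :=
  [/\ {within `[0, T], continuous z},
      forall t, 0 <= t <= T -> X (z t) &
      exists2 E : set R, finite_set E &
        forall t, 0 < t < T -> ~ E t ->
          is_derive t (1 : R) z (F (z t) (u t))].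

(* [U] is the class of admissible inputs. Solutions need not exist for all
   times: outputs are compared on a common interval [0, T]. *)
Definition distinguishable (R : realType) (V : normedModType R) (W Y : Type)
    (X : set V) (U : set (R -> W)) (F : V -> W -> V) (h : V -> Y)
    (a b : V) : Prop :=
  exists (u : R -> W) (T : R) (z1 z2 : R -> V),
    [/\ U u, 0 < T,
        trajectory X F u T z1 /\ z1 0 = a,
        trajectory X F u T z2 /\ z2 0 = b &
        exists2 t, 0 <= t <= T & h (z1 t) <> h (z2 t)].

Definition observable (R : realType) (V : normedModType R) (W Y : Type)
    (X : set V) (U : set (R -> W)) (F : V -> W -> V) (h : V -> Y) : Prop :=
  forall a b, X a -> X b -> a <> b -> distinguishable X U F h a b.

Definition detectable (R : realType) (V : normedModType R) (W Y : Type)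
    (X : set V) (U : set (R -> W)) (F : V -> W -> V) (h : V -> Y) : Prop :=
  forall (u : R -> W) (z1 z2 : R -> V), U u ->
    (forall T, 0 < T -> trajectory X F u T z1) ->
    (forall T, 0 < T -> trajectory X F u T z2) ->
    (forall t, 0 <= t -> h (z1 t) = h (z2 t)) ->
    (z1 t - z2 t) @[t --> +oo] --> (0 : V).

(* The augmented state is z = col_mx x (col_mx K theta). *)
Definition st_x (R : realType) (p l : nat) (z : 'cV[R]_(p + (p + l))) :
  'cV[R]_p := usubmx z.

Definition st_K (R : realType) (p l : nat) (z : 'cV[R]_(p + (p + l))) :
  'cV[R]_p := usubmx (dsubmx z).

Definition st_theta (R : realType) (p l : nat) (z : 'cV[R]_(p + (p + l))) :
  'cV[R]_l := dsubmx (dsubmx z).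

(* The constant K is a nonzero vector. *)
Definition aug_states (R : realType) (p l : nat) :
  set 'cV[R]_(p + (p + l)) := [set z | st_K z != 0].

Definition aug_field (R : realType) (p m l : nat)
    (A : 'M[R]_p) (B : 'M[R]_(p, m))
    (gamma : 'cV[R]_p -> 'cV[R]_m -> 'cV[R]_l -> 'cV[R]_p)
    (z : 'cV[R]_(p + (p + l))) (u : 'cV[R]_m) : 'cV[R]_(p + (p + l)) :=
  col_mx (A *m st_x z + B *m u + gamma (st_x z) u (st_theta z) + st_K z)
         (col_mx 0 0).

Definition aug_output (R : realType) (p q l : nat) (C : 'M[R]_(q, p))
    (z : 'cV[R]_(p + (p + l))) : 'cV[R]_q := C *m st_x z.

(* Main.v *)
(* If C v = 0 with v <> 0, fix theta = theta0, so that the unmodeled dynamics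
   reduce to the constant K. Shifting x by v and K by - A v then produces
   another solution at the constant distance v in x, under any input: the two
   states are indistinguishable and their trajectories do not merge. It remains
   to exhibit such a pair of solutions with both values of K nonzero: for
   A v <> 0 the equilibria - 2 v and - v will do (K = 2 A v and A v), and for
   A v = 0 the solutions t v and v + t v (K = v for both). *)
Require Import Defs.
From mathcomp Require Import all_boot all_order all_algebra.
From mathcomp Require Import all_classical all_reals all_analysis.
From mathcomp Require Import ring lra.
Set Implicit Arguments.
Unset Strict Implicit.
Unset Printing Implicit Defensive.
Import Order.TTheory GRing.Theory Num.Theory.
Import numFieldNormedType.Exports.
Local Open Scope classical_set_scope.
Local Open Scope ring_scope.

(** * Calculus with finitely many exceptional times *)

(** Induction on [s]: an exceptional point inside the interval splits it in two, and continuity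
    glues the inequalities together. With no exceptional point left, this is the mean value theorem.
    The list [s] stands for the switching times of a trajectory. *)
Lemma is_derive_le0_le (R : realType) (f df : R -> R) (s : seq R) (a b : R) :
  a <= b -> {within `[a, b], continuous f} ->
  (forall t, a < t < b -> t \notin s -> is_derive t 1 f (df t)) ->
  (forall t, a < t < b -> t \notin s -> df t <= 0) ->
  f b <= f a.
Proof.
elim: s a b => [|c s IHs] a b ab fcont fdf df_le0.
  move: ab fcont fdf df_le0; rewrite le_eqVlt.
  move=> /predU1P[->//|ab] fcont fdf df_le0.
  have [t|c cab fba] := MVT ab _ fcont (df := df).
    by rewrite in_itv/= => tab; exact: fdf.
  rewrite -subr_le0 fba; apply: mulr_le0_ge0; last by rewrite subr_ge0 ltW.
  by apply: df_le0; move: cab; rewrite ?in_itv.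
have [/andP[ac cb]|cNab] := boolP (a < c < b).
  apply: (@le_trans _ _ (f c)); apply: IHs.
  - exact: ltW.
  - apply: continuous_subspaceW fcont.
    by apply: subset_itvr; rewrite bnd_simp ltW.
  - move=> t /andP[ct tb] ts; apply: fdf; first by rewrite (lt_trans ac).
    by rewrite inE negb_or gt_eqF.
  - move=> t /andP[ct tb] ts; apply: df_le0; first by rewrite (lt_trans ac).
    by rewrite inE negb_or gt_eqF.
  - exact: ltW.
  - apply: continuous_subspaceW fcont.
    by apply: subset_itvl; rewrite bnd_simp ltW.
  - move=> t /andP[at_ tc] ts; apply: fdf; first by rewrite at_ (lt_trans tc).
    by rewrite inE negb_or lt_eqF.
  - move=> t /andP[at_ tc] ts; apply: df_le0; first by rewrite at_ (lt_trans tc).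
    by rewrite inE negb_or lt_eqF.
(* Here [c] lies outside the open interval, so dropping it from the list excludes no fewer times. *)
by apply: IHs => // t tab ts; [apply: fdf|apply: df_le0] => //;
  rewrite inE negb_or ts andbT; apply: contraNneq cNab => <-.
Qed.

Lemma is_derive_eq0_cst (R : realType) (f : R -> R) (s : seq R) (a b : R) :
  a <= b -> {within `[a, b], continuous f} ->
  (forall t, a < t < b -> t \notin s -> is_derive t 1 f 0) ->
  f b = f a.
Proof.
move=> ab fcont fdf; apply/eqP; rewrite eq_le; apply/andP; split.
  exact: (@is_derive_le0_le _ f (cst 0) s).
rewrite -lerN2; apply: (@is_derive_le0_le _ (- f) (cst 0) s _ _ ab) => //.
  by move=> t; apply: continuousN; exact: fcont.
move=> t tab ts; rewrite -[cst 0 t]oppr0.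
by apply: is_deriveN; exact: fdf.
Qed.

Lemma is_derive_coord (R : realType) (m n : nat) (M : R -> 'M[R]_(m, n))
    (dM : 'M[R]_(m, n)) (t : R) i j :
  is_derive t 1 M dM -> is_derive t 1 (fun t => M t i j) (dM i j).
Proof.
move=> MdM; have /derivable_mxP Md := @ex_derive _ _ _ _ _ _ _ MdM.
apply: DeriveDef; first exact: Md.
have <- := @derive_val _ _ _ _ _ _ _ MdM.
by rewrite derive_mx ?mxE//; apply/derivable_mxP.
Qed.

Lemma within_continuous_coord (R : realType) (m n : nat) (D : set R)
    (M : R -> 'M[R]_(m, n)) i j :
  {within D, continuous M} -> {within D, continuous (fun t => M t i j)}.
Proof.
apply: (@within_continuous_comp _ _ _ D M (fun N => N i j)) => N _.
exact: coord_continuous.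
Qed.

Lemma ex_mulmx_eq0 (F : fieldType) (q p : nat) (C : 'M[F]_(q, p)) :
  \rank C != p -> exists2 v : 'cV[F]_p, v != 0 & C *m v = 0.
Proof.
move=> rC; have : kermx C^T != 0.
  by rewrite kermx_eq0 /row_free mxrank_tr.
move=> /rowV0Pn[v /sub_kermxP vC v0]; exists v^T.
  by rewrite trmx_eq0.
by rewrite -[C]trmxK -trmx_mul vC trmx0.
Qed.

Lemma linear_ode_eq0 (R : realType) (p : nat) (A : 'M[R]_p)
    (w : 'I_p -> R -> R) (s : seq R) (a b : R) :
  a <= b -> (forall i, {within `[a, b], continuous (w i)}) ->
  (forall i t, a < t < b -> t \notin s ->
    is_derive t 1 (w i) (\sum_j A i j * w j t)) ->
  (forall i, w i a = 0) -> forall i, w i b = 0.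
Proof.
move=> ab wcont wdw wa0.
(* Gronwall: expR (- 2 c t) * |w t|^2 is nonincreasing. *)
pose c := \sum_i \sum_j `|A i j|.
pose N t := \sum_i w i t ^+ 2.
pose g : R -> R := expR \o ((- 2 * c) \*: id).
have c_ge0 : 0 <= c by apply: sumr_ge0 => i _; apply: sumr_ge0.
have w_le_N i t : `|w i t| ^+ 2 <= N t.
  rewrite real_normK ?num_real// /N (bigD1 i)//= lerDl sumr_ge0// => j _.
  exact: sqr_ge0.
have energy t : \sum_i w i t * (\sum_j A i j * w j t) <= c * N t.
  rewrite mulr_suml; apply: ler_sum => i _.
  rewrite mulr_sumr mulr_suml; apply: ler_sum => j _.
  rewrite mulrCA (le_trans (ler_norm _))// !normrM ler_wpM2l//.
  by have := w_le_N i t; have := w_le_N j t; nra.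
have gder (t : R) : is_derive t (1 : R) g (expR (- 2 * c * t) * (- 2 * c)).
  apply: is_derive1_comp; rewrite -[X in is_derive _ _ _ X]mulr1.
  exact: is_deriveZ.
pose f : R -> R := (\sum_i (w i ^+ 2)) * g.
have fE t : f t = N t * g t.
  by rewrite /f /N fctE fct_sumE.
have fba : f b <= f a.
  pose df t :=
    (\sum_i 2 * (w i t * (\sum_j A i j * w j t)) - 2 * c * N t) * g t.
  apply: (@is_derive_le0_le _ f df s) => //.
  - move=> t; apply: continuousM.
      have : {within `[a, b], continuous (\sum_i w i ^+ 2)}.
        elim/big_ind : _ => [||i _].
      - by apply: continuous_subspaceT => ?; exact: cvg_cst.
      - by move=> ? ?; exact: within_continuousD.
      - by move=> x; rewrite expr2; apply: continuousM; exact: wcont.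
      exact.
    apply: continuous_subspaceT => x; apply: differentiable_continuous.
    exact/derivable1_diffP/ex_derive.
  - move=> t tab ts; apply: is_derive_eq.
      apply: is_deriveM; apply: is_derive_sum => i.
      by apply: is_deriveX; exact: wdw.
    rewrite /df /GRing.scale/= fct_sumE -/(N t) -/(g t).
    rewrite (eq_bigr (fun i => 2 * (w i t * \sum_j A i j * w j t))); last first.
      by move=> i _; rewrite expr1 mulrA.
    set S := \sum_i _; rewrite [expR _](_ : _ = g t)//; ring.
  - move=> t _ _; rewrite /df mulr_le0_ge0 ?expR_ge0// -mulr_sumr -mulrA -mulrBr.
    by rewrite pmulr_rle0// subr_le0.
have Nb : N b = 0.
  apply/eqP; rewrite eq_le; apply/andP; split; last first.
    by apply: sumr_ge0 => i _; exact: sqr_ge0.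
  (* Since [N a = 0], this reads [N b * g b <= 0] with [g b > 0]. *)
  move: fba; rewrite !fE {2}/N big1 ?mul0r ?pmulr_lle0 ?expR_gt0//.
  by move=> i _; rewrite wa0 expr0n.
move=> i; apply/eqP; rewrite -sqrf_eq0; apply/eqP.
by apply: (psumr_eq0P _ Nb) => // j _; exact: sqr_ge0.
Qed.

Lemma is_derive_affine (R : realType) (V : normedModType R) (c d : V) (t : R) :
  is_derive t (1 : R) (fun t => c + t *: d) d.
Proof.
rewrite -[X in is_derive _ _ _ X]add0r; apply: is_deriveD.
apply: DeriveDef; first exact/derivable1_diffP.
by rewrite deriveE// diff_val scale1r.
Qed.

(** * Solutions of the augmented system with parameter [theta0] *)

Section augmented_system.
Context {R : realType} {p m l : nat} (A : 'M[R]_p) (B : 'M[R]_(p, m)).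
Variables (gamma : 'cV[R]_p -> 'cV[R]_m -> 'cV[R]_l -> 'cV[R]_p).
Variables (theta0 : 'cV[R]_l) (gamma0 : forall x u, gamma x u theta0 = 0).
Implicit Types (x k v : 'cV[R]_p) (u : R -> 'cV[R]_m)
  (z : R -> 'cV[R]_(p + (p + l))).

Local Notation traj := (trajectory (@aug_states R p l) (aug_field A B gamma)).

(** Candidate motion with constant velocity [k] under zero input: [K = k - A x] is chosen so that
    [A x + K = k]. The form [c + t *: d] makes the derivative immediate. *)
Definition affine_sol x k (t : R) : 'cV[R]_(p + (p + l)) :=
  col_mx x (col_mx (k - A *m x) theta0) + t *: col_mx k 0.

Lemma affine_solE x k t :
  affine_sol x k t = col_mx (x + t *: k) (col_mx (k - A *m x) theta0).
Proof. by rewrite /affine_sol scale_col_mx add_col_mx scaler0 addr0. Qed.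

(** [A k = 0] keeps [A (x + t k)] equal to [A x], so the velocity stays [k]; the other hypothesis
    says that [K] is nonzero. *)
Lemma affine_sol_trajectory x k T :
  A *m k = 0 -> k != A *m x -> traj (fun=> 0) T (affine_sol x k).
Proof.
move=> Ak kNAx; split.
- apply: continuous_subspaceT => t; apply: differentiable_continuous.
  apply/derivable1_diffP; apply: (@ex_derive _ _ _ _ _ _ (col_mx k 0)).
  exact: is_derive_affine.
- move=> t _; rewrite /aug_states/= affine_solE /st_K col_mxKd col_mxKu.
  by rewrite subr_eq0.
- exists set0 => // t _ _.
  rewrite affine_solE /aug_field /st_x /st_K /st_theta !(col_mxKu, col_mxKd).
  rewrite gamma0 mulmx0 mulmxDr -scalemxAr Ak scaler0 !addr0 addrC subrK.
  rewrite col_mx0.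
  exact: is_derive_affine.
Qed.

(** The lower block of the field is zero, and continuity prevents jumps of [K] and [theta] at the
    switching times. *)
Lemma param_trajectory_cst u T z t :
  traj u T z -> 0 <= t <= T -> dsubmx (z t) = dsubmx (z 0).
Proof.
move=> [zcont _ [E /finite_seqP[s ->] dz]] /andP[t0 tT].
apply/matrixP => i j; rewrite !mxE.
apply: (@is_derive_eq0_cst _ (fun t => z t (rshift p i) j) s) => //.
  apply: within_continuous_coord; apply: continuous_subspaceW zcont.
  by apply: subset_itvl; rewrite bnd_simp.
move=> r /andP[r0 rt] rs.
have rT : 0 < r < T by rewrite r0 (lt_le_trans rt).
have := is_derive_coord (rshift p i) j (dz r rT (negP rs)).
by rewrite /aug_field col_mxEd col_mx0 mxE.
Qed.

(* x2 - x1 - v solves e' = A e with e 0 = 0, whatever the input. *)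
Lemma x_trajectory_shift v u T z1 z2 t :
  traj u T z1 -> traj u T z2 -> st_theta (z1 0) = theta0 ->
  z2 0 = z1 0 + col_mx v (col_mx (- (A *m v)) 0) ->
  0 <= t <= T -> st_x (z2 t) = st_x (z1 t) + v.
Proof.
move=> tz1 tz2 th z20 tT; have /andP[t0 tleT] := tT.
have [z1cont _ [_ /finite_seqP[s1 ->] dz1]] := tz1.
have [z2cont _ [_ /finite_seqP[s2 ->] dz2]] := tz2.
have th20 : st_theta (z2 0) = theta0.
  by rewrite /st_theta z20 !linearD/= !(col_mxKu, col_mxKd) addr0.
have K20 : st_K (z2 0) = st_K (z1 0) - A *m v.
  by rewrite /st_K z20 !linearD/= !(col_mxKu, col_mxKd).
pose w i (r : R) :=
  z2 r (lshift (p + l) i) 0 - z1 r (lshift (p + l) i) 0 - v i 0.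
suff w0 i : w i t = 0.
  apply/matrixP => i j; rewrite ord1 !mxE; have := w0 i; rewrite /w; lra.
(* The two trajectories may have different exceptional times, hence the concatenation. *)
apply: (@linear_ode_eq0 _ _ A w (s1 ++ s2) 0) => //.
- have itv0 : `[0, t] `<=` `[0, T] by apply: subset_itvl; rewrite bnd_simp.
  move=> {}i; apply: within_continuousB; last first.
    by apply: continuous_subspaceT => ?; exact: cvg_cst.
  by apply: within_continuousB; apply: within_continuous_coord;
    exact: (continuous_subspaceW itv0).
- move=> {}i r /andP[r0 rt]; rewrite mem_cat negb_or => /andP[rs1 rs2].
  have rT : 0 < r < T by rewrite r0 (lt_le_trans rt).
  have rT' : 0 <= r <= T by case/andP: rT => /ltW -> /ltW.
  apply: is_derive_eq.
    apply: is_deriveB; apply: is_deriveB; apply: is_derive_coord.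
      exact: (dz2 r rT (negP rs2)).
    exact: (dz1 r rT (negP rs1)).
  (* Freezing [K] and [theta] at their initial values kills both [gamma] terms; [B u] cancels, and
     the gap [- A v] between the two [K] turns [A (x2 - x1)] into [A (x2 - x1 - v)]. *)
  rewrite /aug_field !col_mxEu /st_K /st_theta.
  rewrite !(param_trajectory_cst tz1 rT') !(param_trajectory_cst tz2 rT').
  rewrite -/(st_K _) -/(st_K _) -/(st_theta _) -/(st_theta _).
  rewrite th th20 K20 !gamma0.
  have -> : \sum_j A i j * w j r = (A *m (st_x (z2 r) - st_x (z1 r) - v)) i 0.
    by rewrite mxE; apply: eq_bigr => j _; rewrite /w !mxE.
  by rewrite !mulmxBr !mxE; ring.
- by move=> {}i; rewrite /w z20 mxE col_mxEu; ring.
Qed.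

Lemma not_observable_detectable q (C : 'M[R]_(q, p)) v
    (U : set (R -> 'cV[R]_m)) :
  U (fun=> 0) -> v != 0 -> C *m v = 0 ->
  ~ observable (@aug_states R p l) U (aug_field A B gamma) (aug_output C) /\
  ~ detectable (@aug_states R p l) U (aug_field A B gamma) (aug_output C).
Proof.
move=> U0 v0 Cv.
(* The two inequalities make [K] nonzero for the motions starting at [x] and at [x + v]. *)
have [x [k [Ak kNAx kNAxv]]] : exists x k,
    [/\ A *m k = 0, k != A *m x & k != A *m (x + v)].
  have [Av|Av] := eqVneq (A *m v) 0.
    by exists 0, v; rewrite add0r mulmx0 Av.
  (* Starting from [0] or [- v] instead would make one of the two equilibria the origin, where
     [K = 0]. *)
  exists (- (v *+ 2)), 0; rewrite mulmx0 mulr2n opprD addrNK mulmxDr !mulmxN.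
  split; rewrite // eq_sym ?oppr_eq0// -opprD oppr_eq0 -mulr2n -scaler_nat.
  by rewrite scaler_eq0 (negPf Av) pnatr_eq0.
pose d : 'cV[R]_(p + (p + l)) := col_mx v (col_mx (- (A *m v)) 0).
have d0 : d != 0 by rewrite col_mx_eq0 (negPf v0).
have shift t : affine_sol (x + v) k t = affine_sol x k t + d.
  by rewrite !affine_solE !add_col_mx addr0 addrAC mulmxDr opprD addrA.
have tr1 T := affine_sol_trajectory T Ak kNAx.
have tr2 T := affine_sol_trajectory T Ak kNAxv.
have in_states (z : R -> 'cV[R]_(p + (p + l))) :
    traj (fun=> 0) 1 z -> aug_states (z 0).
  by case=> _ + _; apply; rewrite lexx ler01.
split.
- move=> obs.
  have [||ab|u [T [z1 [z2 [_ T0 [tz1 z10] [tz2 z20] [t tT]]]]]] :=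
    obs (affine_sol x k 0) (affine_sol (x + v) k 0); try exact: in_states.
    move: ab; rewrite shift -[LHS]addr0 => /addrI/esym/eqP.
    by rewrite (negPf d0).
  (* The input and the two trajectories are arbitrary here, only the initial states being known; the
     shift by [v] is invisible through [C]. *)
  apply; rewrite /aug_output (x_trajectory_shift tz1 tz2 _ _ tT (v := v)).
  + by rewrite mulmxDr Cv addr0.
  + by rewrite z10 affine_solE /st_theta !col_mxKd.
  + by rewrite z20 z10 shift.
- move=> /(_ _ (affine_sol x k) (affine_sol (x + v) k) U0) det.
  have lim0 : (affine_sol x k t - affine_sol (x + v) k t) @[t --> +oo] -->
      (0 : 'cV[R]_(p + (p + l))).
    apply: det => // t _; rewrite /aug_output !affine_solE /st_x !col_mxKu.
    by rewrite !mulmxDr Cv addr0.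
  (* A constant difference converges to itself, so a limit [0] would force [d = 0]. *)
  have diffE : (fun t => affine_sol x k t - affine_sol (x + v) k t) = cst (- d).
    by apply/funext => t/=; rewrite shift opprD addrA subrr add0r.
  move: lim0; rewrite diffE => lim0.
  have dE : - d = 0 := norm_cvg_unique (cvg_cst (- d)) lim0.
  by move: d0; rewrite -oppr_eq0 dE eqxx.
Qed.

End augmented_system.

Theorem theorem1 (R : realType) (p m q l : nat)
    (A : 'M[R]_p) (B : 'M[R]_(p, m)) (C : 'M[R]_(q, p))
    (gamma : 'cV[R]_p -> 'cV[R]_m -> 'cV[R]_l -> 'cV[R]_p)
    (hgamma : exists theta0 : 'cV[R]_l, forall x u, gamma x u theta0 = 0)
    (U : set (R -> 'cV[R]_m)) (hU : U (fun=> 0)) :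
  (observable (@aug_states R p l) U (aug_field A B gamma) (aug_output C) ->
     \rank C = p) /\
  (detectable (@aug_states R p l) U (aug_field A B gamma) (aug_output C) ->
     \rank C = p).
Proof.
have [theta0 gamma0] := hgamma.
have [//|/ex_mulmx_eq0[v v0 Cv]] := eqVneq (\rank C) p.
have [Nobs Ndet] := not_observable_detectable A B gamma0 hU v0 Cv.
by split=> [/Nobs|/Ndet].
Qed.
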